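(* Let $\Delta$ be a labeled diagram with nodes $\{1,\dots,n\}$ satisfying conditions (N1)–(N3) of the context. Choose $\mathcal{J}_{\Delta,2}\subset\mathcal{J}_\Delta\subset\mathcal{I}_\Delta$ so that $\mathcal{J}_{\Delta,2}$ parametrizes a maximal set of $\mathbb{Z}_2$-linearly independent rows of $M_{\Delta,2}$ and $\mathcal{J}_\Delta$ parametrizes a maximal set of $\mathbb{R}$-linearly independent rows of $M_\Delta$. Set $$W=\Big\{\sum_{I\in\mathcal{I}_\Delta} c_I E_I\in V_\Delta \;\Big|\; c_I=1\ \forall I\in\mathcal{J}_{\Delta,2},\ c_I=\pm1\ \forall I\in\mathcal{J}_\Delta\setminus\mathcal{J}_{\Delta,2}\Big\}.$$ Then $\mathring{W}=W\cap\mathring{V}_\Delta$ is a fundamental domain in $\mathring{V}_\Delta$ for the action of $D_n$, i.e. $\mathring{W}$ is a submanifold of $\mathring{V}_\Delta$ that intersects each $D_n$-orbit in $\mathring{V}_\Delta$ in a single point.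
   Context: A labeled diagram is a finite directed acyclic graph with no multiple arrows with the same source and destination, together with a function assigning to each arrow a node, its label; $i\xrightarrow{j}k$ denotes an arrow from $i$ to $k$ with label $j$. Conditions: (N1) two distinct arrows with the same source have different labels; (N2) two distinct arrows with the same destination have different labels; (N3) if $i\xrightarrow{j}k$ is an arrow, then $i\neq j$ and $j\xrightarrow{i}k$ is also an arrow. $\mathcal{I}_\Delta$ is the set of $I=\{\{i,j\},k\}$ with $i\xrightarrow{j}k$. For such $I$ with $i<j$, $E_I=e^{ij}\otimes e_k\in\Lambda^2(\mathbb{R}^n)^*\otimes\mathbb{R}^n$, where $e^{ij}=e^i\wedge e^j$. $V_\Delta$ is the real vector space with basis the $E_I$, $I\in\mathcal{I}_\Delta$, and $\mathring{V}_\Delta$ is the set of $\sum c_IE_I\in V_\Delta$ with all $c_I\neq0$. $D_n$ is the group of invertible real diagonal $n\times n$ matrices acting on $V_\Delta$ as a subgroup of $\mathrm{GL}(n,\mathbb{R})$: $\operatorname{diag}(g_1,\dots,g_n)$ sends $E_I$ to $\frac{g_k}{g_ig_j}E_I$ for $I=\{\{i,j\},k\}$. $M_\Delta$ (the root matrix) has rows indexed by $\mathcal{I}_\Delta$ (with a chosen total order) and $n$ columns; the row indexed by $\{\{i,j\},k\}$ has entries $-1$ in columns $i$ and $j$, $+1$ in column $k$, and $0$ elsewhere. $M_{\Delta,2}$ is its reduction modulo $2$, with entries in $\mathbb{Z}_2$. *)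

(* Defs.v *)
From mathcomp Require Import all_boot all_order all_algebra.
From mathcomp Require Import ring.
From mathcomp Require Import all_classical all_reals all_analysis.
Set Implicit Arguments.
Unset Strict Implicit.
Unset Printing Implicit Defensive.
Import Order.TTheory GRing.Theory Num.Theory.
Import numFieldNormedType.Exports.
Local Open Scope classical_set_scope.
Local Open Scope ring_scope.

(* [label i k = Some j] means that there is an arrow from i to k and that its
   label is j; [label i k = None] means that there is no arrow from i to k. *)
Record labeled_diagram (T : finType) := LabeledDiagram {
  label : T -> T -> option T;
  label_acyclic :
    forall p : seq T, cycle (fun i k => label i k != None) p -> p = [::]
}.

Section Diagrams.
Variables (T : finType) (D : labeled_diagram T).

Definition larrow (i j k : T) : bool := label D i k == Some j.

Definition cond_N1 : Prop :=
  forall i j k k', larrow i j k -> larrow i j k' -> k = k'.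
Definition cond_N2 : Prop :=
  forall i i' j k, larrow i j k -> larrow i' j k -> i = i'.
Definition cond_N3 : Prop :=
  forall i j k, larrow i j k -> i != j /\ larrow j i k.

Definition root_index_set : {set {set T} * T} :=
  [set I : {set T} * T |
    [exists i, exists j, (I.1 == [set i; j]%SET) && larrow i j I.2]]%SET.

Definition root_index : finType := {I : {set T} * T | I \in root_index_set}.

End Diagrams.

(* The total order on the indices is given by the enumeration [ord]. *)
Definition root_matrix n (D : labeled_diagram 'I_n)
    (ord : 'I_#|root_index D| -> root_index D) : 'M[int]_(#|root_index D|, n) :=
  \matrix_(r, c) ((c == (val (ord r)).2)%:R - (c \in (val (ord r)).1)%:R).

Definition indep_rows (F : fieldType) m n (M : 'M[F]_(m, n)) (S : {set 'I_m}) :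
    bool :=
  row_free (rowsub (fun r : 'I_#|S| => enum_val r) M).

Section BracketSpace.
Variables (R : realType) (n : nat).

(* An element of Lambda^2(R^n)^* (x) R^n is viewed as an alternating bilinear
   map R^n x R^n -> R^n; the type does not record bilinearity, which holds for
   every element of the span V_of below. *)
Definition tensor : lmodType R := 'cV[R]_n -> 'cV[R]_n -> 'cV[R]_n.

Definition e_wedge (i j : 'I_n) (x y : 'cV[R]_n) : R :=
  x i 0 * y j 0 - x j 0 * y i 0.

Definition e_tensor (i j k : 'I_n) : tensor :=
  fun x y => e_wedge i j x y *: delta_mx k 0.

Definition gl_act (g : 'M[R]_n) (B : tensor) : tensor :=
  fun x y => g *m B (invmx g *m x) (invmx g *m y).

Definition Dn : set 'M[R]_n := [set g | is_diag_mx g /\ g \in unitmx].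

Definition Dn_orbit (B : tensor) : set tensor := [set gl_act g B | g in Dn].

Variable D : labeled_diagram 'I_n.

(* For I = ({i, j}, k) with i < j the sum has the single term e^{ij} (x) e_k,
   see [E_ofE]. *)
Definition E_of (I : {set 'I_n} * 'I_n) : tensor :=
  \sum_(i in I.1) \sum_(j in I.1 | (i < j)%N) e_tensor i j I.2.

Definition lincomb (c : root_index D -> R) : tensor :=
  \sum_(I : root_index D) c I *: E_of (val I).

Definition V_of : set tensor := range lincomb.

Definition V_ring : set tensor :=
  [set lincomb c | c in [set c | forall I, c I != 0]].

Definition W_of (J2 J : {set root_index D}) : set tensor :=
  [set lincomb c | c in [set c |
     (forall I, I \in J2 -> c I = 1) /\
     (forall I, I \in J :\: J2 -> c I = 1 \/ c I = -1)]].

(* The linear parametrization of V_of by R^N, N = #|root_index D|, that defines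
   its structure of smooth manifold. *)
Definition V_param (x : 'rV[R]_#|root_index D|) : tensor :=
  lincomb (fun I => x 0 (enum_rank I)).

End BracketSpace.

Arguments e_tensor R {n} i j k.
Arguments E_of R {n} I.
Arguments V_of R {n} D.
Arguments V_ring R {n} D.
Arguments W_of R {n D} J2 J.
Arguments V_param R {n} D x.

Section Submanifolds.
Variable R : realType.

Fixpoint class_C (k m : nat) (O : set 'rV[R]_m) (f : 'rV[R]_m -> 'rV[R]_m) :
    Prop :=
  match k with
  | 0 => forall x, O x -> {for x, continuous f}
  | k'.+1 => (forall x, O x -> differentiable f x)
             /\ forall v, class_C k' O ('D_v f)
  end.

Definition smooth_on m (O : set 'rV[R]_m) (f : 'rV[R]_m -> 'rV[R]_m) : Prop :=
  forall k, class_C k O f.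

Definition diffeomorphism m (O O' : set 'rV[R]_m)
    (phi psi : 'rV[R]_m -> 'rV[R]_m) : Prop :=
  [/\ open O, open O', smooth_on O phi, smooth_on O' psi &
      (forall x, O x -> O' (phi x) /\ psi (phi x) = x) /\
      (forall y, O' y -> O (psi y) /\ phi (psi y) = y)].

(* S is an embedded smooth submanifold of the open subset U of R^m: around each
   of its points, S is straightened to R^d x {0} by a diffeomorphism. *)
Definition submanifold m (U S : set 'rV[R]_m) : Prop :=
  S `<=` U /\
  exists2 d : nat, (d <= m)%N &
    forall p, S p ->
      exists (O O' : set 'rV[R]_m) (phi psi : 'rV[R]_m -> 'rV[R]_m),
        [/\ O p, O `<=` U, diffeomorphism O O' phi psi &
            forall x, O x ->
              (S x <-> forall i : 'I_m, (d <= i)%N -> phi x 0 i = 0)].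

End Submanifolds.

Definition fundamental_domain (R : realType) n (D : labeled_diagram 'I_n)
    (S : set (tensor R n)) : Prop :=
  [/\ S `<=` V_ring R D,
      submanifold (V_param R D @^-1` V_ring R D) (V_param R D @^-1` S) &
      forall v, V_ring R D v -> exists w, S `&` Dn_orbit v = [set w]].

Lemma E_ofE (R : realType) n (i j k : 'I_n) :
  (i < j)%N -> E_of R ([set i; j]%SET, k) = e_tensor R i j k.
Proof.
move=> ij; have nij : i != j by rewrite neq_ltn ij.
rewrite /E_of /= big_setU1 ?inE //= big_set1.
rewrite !big_mkcondr /= !big_setU1 ?inE //= !big_set1.
by rewrite !ltnn ij ltnNge (ltnW ij) /= add0r !addr0.
Qed.

Lemma gl_act_e_tensor (R : realType) n (d : 'rV[R]_n) (i j k : 'I_n) :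
  (forall i, d 0 i != 0) ->
  gl_act (diag_mx d) (e_tensor R i j k)
    = (d 0 k / (d 0 i * d 0 j)) *: e_tensor R i j k.
Proof.
move=> d0; pose d' := \row_i (d 0 i)^-1.
have dV : diag_mx d *m diag_mx d' = 1%:M.
  rewrite mulmx_diag -diag_const_mx; congr diag_mx.
  by apply/rowP => l; rewrite !mxE divff.
have dU : diag_mx d \in unitmx by have [] := mulmx1_unit dV.
have -> : gl_act (diag_mx d) (e_tensor R i j k) = (fun x y =>
    diag_mx d *m e_tensor R i j k (diag_mx d' *m x) (diag_mx d' *m y)).
  have -> // : diag_mx d' = invmx (diag_mx d).
  by rewrite -[RHS]mulmx1 -dV mulKmx.
apply/funext => x; apply/funext => y; apply/colP => l.
have -> : ((d 0 k / (d 0 i * d 0 j)) *: e_tensor R i j k) x y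
    = (d 0 k / (d 0 i * d 0 j)) *: e_tensor R i j k x y by [].
rewrite /e_tensor /e_wedge !mul_diag_mx !mxE.
have [->|] := eqVneq l k; last by rewrite !mulr0.
rewrite /= !mulr1 invfM; ring.
Qed.

(* Main.v *)
(* The diagonal matrix diag(d) multiplies the coefficient c_I by a weight which
   is multiplicative in d. Taking logarithms of absolute values turns weights
   into the product of the root matrix over R with the vector (log |d_i|), and
   taking signs turns them into its product over F_2 with the vector of signs.
   Linear independence of the rows in J (resp. J2) lets one choose the absolute
   values (resp. the signs) of the d_i so that the coefficients indexed by J
   (resp. J2) become +-1 (resp. positive); maximality says that these
   coefficients determine the absolute values (resp. signs) of all the weights.
   The submanifold property holds because, near a point p, the set is the slice
   x_I = p_I for I in J. *)
Require Import Defs.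
From mathcomp Require Import all_boot all_order all_algebra.
From mathcomp Require Import fingroup perm.
From mathcomp Require Import all_classical all_reals all_analysis.
Set Implicit Arguments.
Unset Strict Implicit.
Unset Printing Implicit Defensive.
Import Order.TTheory GRing.Theory Num.Theory.
Import numFieldNormedType.Exports.
Local Open Scope classical_set_scope.
Local Open Scope ring_scope.

(** * Independent sets of rows and maximality *)

Section IndependentRows.
Variables (F : fieldType) (m n : nat) (M : 'M[F]_(m, n)).

(** A free row submatrix has a right inverse [B], and [B] applied to the prescribed values is a
    solution. *)
Lemma indep_rows_solve (A : {set 'I_m}) (b : 'I_m -> F) :
  indep_rows M A ->
  exists t : 'cV[F]_n, forall r, r \in A -> (M *m t) r 0 = b r.
Proof.
move=> /row_freeP[B MB1]; exists (B *m \col_r b (enum_val r)) => r rA.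
have /matrixP/(_ (enum_rank_in rA r) 0) :
    rowsub (fun r : 'I_#|A| => enum_val r) M *m (B *m \col_r b (enum_val r))
    = \col_r b (enum_val r) by rewrite mulmxA MB1 mul1mx.
by rewrite mul_rowsub_mx !mxE enum_rankK_in // => <-; apply: eq_bigr => j _.
Qed.

(** Relations are taken as full-length row vectors supported in [A], so that relations for [S] and
    for a larger set can be compared without reindexing. *)
Lemma indep_rowsP (A : {set 'I_m}) :
  reflect (forall u : 'rV[F]_m, (forall r, r \notin A -> u 0 r = 0) ->
             u *m M = 0 -> u = 0)
          (indep_rows M A).
Proof.
have sumA (u : 'rV[F]_m) : (forall r, r \notin A -> u 0 r = 0) ->
    u *m M = (\row_(r < #|A|) u 0 (enum_val r)) *m
             rowsub (fun r : 'I_#|A| => enum_val r) M.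
  move=> u0; apply/rowP => j; rewrite !mxE.
  rewrite (bigID (mem A)) /= [X in _ + X]big1 ?addr0; last first.
    by move=> r rA; rewrite u0 // mul0r.
  by rewrite big_enum_val; apply: eq_bigr => r _; rewrite !mxE.
apply: (iffP idP) => [free u u0 | indep].
  rewrite sumA // => /eqP; rewrite mulmx_free_eq0 // => /eqP/rowP uA.
  apply/rowP => r; rewrite mxE; have [rA|/u0//] := boolP (r \in A).
  by have := uA (enum_rank_in rA r); rewrite !mxE enum_rankK_in.
rewrite /indep_rows -kermx_eq0; apply/eqP/row_matrixP => i; rewrite row0.
set v := row i _.
have vM0 : v *m rowsub (fun r : 'I_#|A| => enum_val r) M = 0.
  by rewrite /v -row_mul mulmx_ker row0.
(* Extension of [v] by zero outside [A]: the sum has at most one term. *)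
pose u : 'rV[F]_m := \row_r (\sum_(s < #|A| | enum_val s == r) v 0 s).
have uE s : u 0 (enum_val s) = v 0 s.
  rewrite mxE (big_pred1 s) // => s'; exact: (inj_eq enum_val_inj).
have u0 : u = 0.
  have uN r : r \notin A -> u 0 r = 0.
    move=> rA; rewrite mxE big1 // => s /eqP sr.
    by rewrite -sr enum_valP in rA.
  apply: indep => //; rewrite sumA //.
  by under eq_mx do rewrite uE; rewrite [\matrix_(_, _) _](_ : _ = v) //;
     apply/rowP => s; rewrite !mxE.
by apply/rowP => s; rewrite -uE u0 !mxE.
Qed.

(* If the r-th entry of M t were nonzero, pairing a linear relation among the
   row r and the rows in S with t would kill the coefficient of r, so these rows
   would be independent. *)
Lemma maximal_indep_rows_ker (T : finType) (f : 'I_m -> T) (S : {set T})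
    (t : 'cV[F]_n) :
  bijective f ->
  maxset (fun S : {set T} => indep_rows M (f @^-1: S)) S ->
  (forall r, f r \in S -> (M *m t) r 0 = 0) -> M *m t = 0.
Proof.
move=> [g fK gK] /maxsetP[/indep_rowsP indepS maxS] tS0.
apply/colP => r; rewrite [RHS]mxE; apply/eqP/negPn/negP => tr_neq0.
have rS : f r \notin S by apply: contra tr_neq0 => /tS0 ->.
suff /maxS /(_ (subsetU1 _ _)) eqS : indep_rows M (f @^-1: (f r |: S)).
  by rewrite -eqS setU11 in rS.
apply/indep_rowsP => u u0 uM0.
suff ur0 : u 0 r = 0.
  apply: indepS => // q; rewrite inE => qS.
  have [->//|qr] := eqVneq q r; apply: u0.
  by rewrite !inE (negbTE qS) (inj_eq (can_inj fK)) (negbTE qr).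
have : (u *m (M *m t)) 0 0 = 0 by rewrite mulmxA uM0 mul0mx mxE.
rewrite mxE (bigD1 r) //= big1 => [|q qr]; last first.
  have [qS|qS] := boolP (f q \in S); first by rewrite tS0 ?mulr0.
  by rewrite u0 ?mul0r // !inE (negbTE qS) (inj_eq (can_inj fK)) (negbTE qr).
by rewrite addr0 => /eqP; rewrite mulf_eq0 (negbTE tr_neq0) orbF => /eqP.
Qed.

End IndependentRows.

(** * Weights of diagonal matrices and the root matrix *)

Lemma root_matrix_mul (F : fieldType) n (D : labeled_diagram 'I_n)
    (ord : 'I_#|root_index D| -> root_index D) (t : 'cV[F]_n) r :
  (map_mx intr (root_matrix ord) *m t) r 0 =
  t (val (ord r)).2 0 - \sum_(i in (val (ord r)).1) t i 0.
Proof.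
rewrite mxE; under eq_bigr do rewrite !mxE rmorphB /= mulrBl.
rewrite sumrB; congr (_ - _).
  rewrite (bigD1 (val (ord r)).2) //= eqxx mul1r big1 ?addr0 // => i /negbTE ->.
  by rewrite mul0r.
rewrite [RHS]big_mkcond; apply: eq_bigr => i _.
by case: (i \in _); rewrite ?mul1r ?mul0r.
Qed.

Section Weights.
Variables (R : realType) (n : nat).

(** The factor by which [diag_mx d] scales [E_of R I] for a root index [I]; the product over [I.1]
    avoids ordering the pair. *)
Definition weight (d : 'rV[R]_n) (I : {set 'I_n} * 'I_n) : R :=
  d 0 I.2 / \prod_(i in I.1) d 0 i.

Implicit Types (d : 'rV[R]_n) (I : {set 'I_n} * 'I_n).

Lemma weight_neq0 d I : (forall i, d 0 i != 0) -> weight d I != 0.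
Proof.
by move=> d0; rewrite mulf_neq0 // invr_neq0 //; apply/prodf_neq0 => i _.
Qed.

(** Stated for any morphism [h] from the nonzero reals to an additive group, so that it serves both
    [log_abs] and [sign_bit]. *)
Lemma morph_weight (F : zmodType) (h : R -> F) d I :
  (forall x y, x != 0 -> y != 0 -> h (x * y) = h x + h y) ->
  (forall i, d 0 i != 0) ->
  h (weight d I) = h (d 0 I.2) - \sum_(i in I.1) h (d 0 i).
Proof.
move=> hM d0.
have h1 : h 1 = 0.
  by apply: (addrI (h 1)); rewrite -hM ?oner_neq0 // mulr1 addr0.
have hV x : x != 0 -> h x^-1 = - h x.
  move=> x0; apply/eqP; rewrite -addr_eq0 -hM ?invr_eq0 //.
  by rewrite mulVf // h1.
(* Nonvanishing is carried through the induction because [hM] applies only to nonzero factors. *)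
have [P0 hP] : \prod_(i in I.1) d 0 i != 0 /\
    h (\prod_(i in I.1) d 0 i) = \sum_(i in I.1) h (d 0 i).
  elim/big_rec2: _ => [|i y x _ [x0 <-]]; first by rewrite oner_neq0.
  by rewrite mulf_neq0 // hM.
by rewrite hM ?invr_eq0 // hV // hP.
Qed.

End Weights.

(** * The isomorphism of the multiplicative group of R with R x F_2, given by [log_abs] and
    [sign_bit] *)

Section Signs.
Variable R : realType.
Implicit Types x y : R.

Definition log_abs x : R := exp.ln `|x|.
Definition sign_bit x : 'F_2 := (x < 0)%R%:R.

Lemma log_absM x y : x != 0 -> y != 0 ->
  log_abs (x * y) = log_abs x + log_abs y.
Proof.
by move=> x0 y0; rewrite /log_abs normrM lnM // posrE normr_gt0.
Qed.

Lemma sign_bitM x y : x != 0 -> y != 0 ->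
  sign_bit (x * y) = sign_bit x + sign_bit y.
Proof.
rewrite /sign_bit => x0 y0.
case: (ltgtP x 0) x0 => // hx _; case: (ltgtP y 0) y0 => // hy _.
- by rewrite ltNge nmulr_rge0 // (ltW hy); apply/eqP.
- by rewrite pmulr_llt0 // hx; apply/eqP.
- by rewrite pmulr_rlt0 // hy; apply/eqP.
- by rewrite ltNge mulr_ge0 ?ltW //=; apply/eqP.
Qed.

Lemma sign_log_inj x y : x != 0 -> y != 0 ->
  log_abs x = log_abs y -> sign_bit x = sign_bit y -> x = y.
Proof.
move=> x0 y0 /ln_inj; rewrite !posrE !normr_gt0 => /(_ x0 y0) xy sxy.
rewrite [x]realEsign ?num_real // [y]realEsign ?num_real // xy.
suff -> : (x < 0) = (y < 0) by [].
by move: sxy; rewrite /sign_bit; do 2!case: (_ < 0).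
Qed.

Lemma sign_log_surj (t : R) (u : 'F_2) :
  exists x, [/\ x != 0, log_abs x = t & sign_bit x = u].
Proof.
exists ((-1) ^+ (u != 0) * expR t); split.
- by rewrite mulf_neq0 ?signr_eq0 // gt_eqF // expR_gt0.
- by rewrite /log_abs normrMsign ger0_norm ?expR_ge0 // expRK.
- rewrite /sign_bit; case: u => [[|[|//]]] p; rewrite /= ?mul1r ?mulN1r.
    by rewrite ltNge expR_ge0 /=; apply/val_inj.
  by rewrite oppr_lt0 expR_gt0; apply/val_inj.
Qed.

End Signs.

Lemma DnP (R : realType) n (g : 'M[R]_n) :
  Dn g <-> exists2 d : 'rV[R]_n, g = diag_mx d & forall i, d 0 i != 0.
Proof.
split=> [[/diag_mxP[d ->]]|[d -> d0]].
  rewrite unitmxE det_diag unitfE => /prodf_neq0 d0.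
  by exists d => // i; apply: d0.
split; first by apply/diag_mxP; exists d.
by rewrite unitmxE det_diag unitfE; apply/prodf_neq0 => i _.
Qed.

(** * Coordinates on V and the diagonal action *)

Section Coordinates.
Variables (R : realType) (n : nat) (D : labeled_diagram 'I_n).
Hypothesis N3 : cond_N3 D.
Implicit Types (I : root_index D) (c : root_index D -> R).

(** By [N3] the two elements of the pair differ, so they can be listed in increasing order, as
    [E_ofE] requires. *)
Lemma root_indexP I :
  exists i j k : 'I_n, (i < j)%N /\ val I = ([set i; j]%SET, k).
Proof.
case: I => [[A k]] /=; rewrite inE.
move=> /existsP[i /existsP[j /andP[/= /eqP -> h]]].
have [nij _] := N3 h.
case: (ltngtP i j) => ij.
- by exists i, j, k.
- by exists j, i, k; rewrite finset.setUC.
- by rewrite (val_inj ij) eqxx in nij.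
Qed.

Lemma lincombE c (x y : 'cV[R]_n) :
  lincomb c x y = \sum_I c I *: E_of R (val I) x y.
Proof. by rewrite /lincomb !fct_sumE. Qed.

(** The coefficient at [I] = ({a, b}, k) with a < b is read off as the k-th coordinate of the value
    at the basis vectors e_a, e_b. *)
Lemma lincomb_inj : injective (@lincomb R n D).
Proof.
move=> c c' cc'; apply/funext => I; have [a [b [k [ab Ik]]]] := root_indexP I.
suff coord (f : root_index D -> R) :
    lincomb f (delta_mx a 0) (delta_mx b 0) k 0 = f I by rewrite -!coord cc'.
rewrite lincombE summxE (bigD1 I) //= big1 ?addr0 => [|I' I'I].
  rewrite Ik E_ofE // /e_tensor /e_wedge !mxE !eqxx.
  by rewrite [b == a]gtn_eqF // mulr0n mul0r subr0 !mulr1.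
have [i [j [l [ij I'l]]]] := root_indexP I'.
rewrite I'l E_ofE // /e_tensor /e_wedge !mxE !andbT.
have [kl|] := eqVneq k l; last by rewrite !(mulr0n, mul0r, mulr0, subr0).
have [ia|_] := eqVneq i a.
  have [jb|_] := eqVneq j b.
    by case/eqP: I'I; apply/val_inj; rewrite /= Ik I'l ia jb kl.
  have [ja|_] := eqVneq j a; first by rewrite ia ja ltnn in ij.
  by rewrite !(mulr0n, mul0r, mulr0, subr0).
(* The second term of the wedge survives only if j = a and i = b, which contradicts i < j and a <
   b. *)
have [ja|_] := eqVneq j a; last by rewrite !(mulr0n, mul0r, mulr0, subr0).
have [ib|_] := eqVneq i b; last by rewrite !(mulr0n, mul0r, mulr0, subr0).
by move: ab; rewrite -ib -ja ltnNge ltnW.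
Qed.

Lemma gl_act_lincomb (d : 'rV[R]_n) c :
  (forall i, d 0 i != 0) ->
  gl_act (diag_mx d) (lincomb c) = lincomb (fun I => weight d (val I) * c I).
Proof.
move=> d0; apply/funext => x; apply/funext => y.
rewrite /gl_act !lincombE mulmx_sumr; apply: eq_bigr => I _.
have [i [j [k [ij ->]]]] := root_indexP I.
have actE : diag_mx d *m e_tensor R i j k (invmx (diag_mx d) *m x)
                                          (invmx (diag_mx d) *m y)
            = (d 0 k / (d 0 i * d 0 j)) *: e_tensor R i j k x y.
  exact: (congr1 (fun B => B x y) (gl_act_e_tensor i j k d0)).
rewrite E_ofE // -scalemxAr actE.
have -> : weight d ([set i; j]%SET, k) = d 0 k / (d 0 i * d 0 j).
  rewrite /weight /= big_setU1 ?big_set1 //= inE.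
  by rewrite neq_ltn ij.
by rewrite scalerA mulrC.
Qed.

End Coordinates.

(** * Affine charts and a slice criterion for submanifolds *)

Section Affine.
Variables (R : realType) (m : nat).
Implicit Types (O U S : set 'rV[R]_m).

Lemma col_perm_continuous (s : 'S_m) :
  continuous (col_perm s : 'rV[R]_m -> 'rV[R]_m).
Proof.
move=> x; apply/(@cvg_ballP _ _ _ _ (nbhs_filter x)) => e e0.
near=> y.
have [_ xy] : ball x e y by near: y; exact: nbhsx_ballx.
by split=> // i j; rewrite !mxE; apply: xy.
Unshelve. all: by end_near.
Qed.

Lemma class_C_cst k O (c : 'rV[R]_m) : class_C k O (cst c).
Proof.
elim: k c => [|k IHk] c /= => [x _|]; first exact: cst_continuous.
split=> [x _|v]; first exact: differentiable_cst.
have -> : 'D_v (cst c) = cst 0 by apply/funext => x; rewrite derive_cst.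
exact: IHk.
Qed.

(** The derivative in direction [v] is the constant [f v], and constants are of every class by
    [class_C_cst]. *)
Lemma smooth_on_affine O (f : {linear 'rV[R]_m -> 'rV[R]_m}) (c : 'rV[R]_m) :
  continuous f -> smooth_on O (fun x => f x + c).
Proof.
move=> fc.
have df x : differentiable (fun x => f x + c) x.
  apply: differentiableD; first exact: linear_differentiable.
  exact: differentiable_cst.
case=> [|k] /=; first by move=> x _; apply: differentiable_continuous.
split=> [x _ //|v].
rewrite [X in class_C _ _ X](_ : _ = cst (f v)); first exact: class_C_cst.
apply/funext => x; rewrite deriveE // (@diffD _ _ _ f (cst c)) //;
  last exact: linear_differentiable.
rewrite -[RHS]addr0; congr (_ + _).
  exact: (congr1 (@^~ v) (diff_lin x fc)).
exact: (congr1 (@^~ v) (diff_cst c x)).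
Qed.

(** The permutation lists the complement of [A] first and then [A], matching the convention of
    [submanifold] that the last coordinates vanish. *)
Lemma perm_to_back (A : {set 'I_m}) :
  exists s : 'S_m, forall i : 'I_m, (m - #|A| <= i)%N = (s i \in A).
Proof.
pose e := enum (~: A)%SET ++ enum A.
have se : size e = m.
  by rewrite size_cat -!cardE -[RHS]card_ord -(cardsC A) addnC.
have ue : uniq e.
  rewrite cat_uniq !enum_uniq /= andbT; apply/hasPn => x.
  by rewrite !mem_enum inE => ->.
have inj : injective (fun i : 'I_m => nth i e i).
  move=> i j; rewrite (set_nth_default i) ?se // => /eqP.
  by rewrite nth_uniq ?se // => /eqP/val_inj.
exists (perm inj) => i; rewrite permE.
have -> : (m - #|A| = #|~: A|)%N by rewrite [RHS]cardsCs finset.setCK card_ord.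
rewrite nth_cat -cardE; case: ltnP => [iA|Ai].
  apply/esym/negbTE.
  by rewrite -finset.in_setC -mem_enum mem_nth // -cardE.
apply/esym; rewrite -mem_enum mem_nth // -cardE.
by rewrite -(ltn_add2r #|~: A|) subnK // cardsC card_ord.
Qed.

(** Translating [p] to 0 and permuting the coordinates in [A] to the back straightens the slice. The
    same [A] at every point gives a constant dimension. *)
Lemma submanifold_locally_slice U S (A : {set 'I_m}) :
  S `<=` U ->
  (forall p, S p -> exists O, [/\ O p, open O, O `<=` U &
     forall x, O x -> (S x <-> forall i, i \in A -> x 0 i = p 0 i)]) ->
  submanifold U S.
Proof.
move=> SU slice; split=> //; exists (m - #|A|)%N; first exact: leq_subr.
move=> p /slice; case=> O [pO openO OU OS].
have [s sA] := perm_to_back A.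
pose phi (x : 'rV[R]_m) := col_perm s x + - col_perm s p.
pose psi (y : 'rV[R]_m) := col_perm s^-1 y + p.
have phiK x : psi (phi x) = x.
  by apply/rowP => i; rewrite !mxE permKV subrK.
have psiK y : phi (psi y) = y.
  by apply/rowP => i; rewrite !mxE permK addrK.
have psi_smooth k V : class_C k V psi.
  exact/smooth_on_affine/col_perm_continuous.
exists O, (psi @^-1` O), phi, psi; split=> //.
  split=> //.
  - by apply: open_comp => // y _; apply: (psi_smooth 0 setT).
  - exact/smooth_on_affine/col_perm_continuous.
  - split=> [x Ox|y Oy]; last by rewrite psiK.
    by rewrite /= phiK.
move=> x /OS ->; split=> [xp i|x0 i iA].
  by rewrite sA !mxE => /xp ->; rewrite subrr.
have := x0 ((s^-1)%g i); rewrite sA permKV => /(_ iA).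
by rewrite !mxE permKV => /eqP; rewrite subr_eq0 => /eqP.
Qed.

End Affine.

(** * Slices, existence and uniqueness of the normal form *)

Section FundamentalDomain.
Variables (R : realType) (n : nat) (D : labeled_diagram 'I_n).
Hypothesis N3 : cond_N3 D.
Implicit Types (I : root_index D) (c : root_index D -> R).

Lemma V_ringP c : V_ring R D (lincomb c) <-> forall I, c I != 0.
Proof.
split=> [[c' c'0 /(lincomb_inj N3) <- //]|c0]; by exists c.
Qed.

Lemma W_ofP (J2 J : {set root_index D}) c :
  W_of R J2 J (lincomb c) <->
  (forall I, I \in J2 -> c I = 1) /\
  (forall I, I \in J :\: J2 -> c I = 1 \/ c I = -1).
Proof.
split=> [[c' Wc' /(lincomb_inj N3) <- //]|Wc]; by exists c.
Qed.

Lemma submanifold_W_ring (J2 J : {set root_index D}) : J2 \subset J ->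
  submanifold (V_param R D @^-1` V_ring R D)
              (V_param R D @^-1` (W_of R J2 J `&` V_ring R D)).
Proof.
move=> J2J; apply: (submanifold_locally_slice (A := enum_val @^-1: J)).
  by move=> x [].
move=> p [/W_ofP[p1 pN1] /V_ringP p0].
have pJ I : I \in J -> p 0 (enum_rank I) = 1 \/ p 0 (enum_rank I) = -1.
  move=> IJ; have [IJ2|IJ2] := boolP (I \in J2); first by left; apply: p1.
  by apply: pN1; rewrite inE IJ2.
(* The open orthant of [p]: it avoids the coordinate hyperplanes, and on it a coordinate equal to 1
   or -1 is determined by its sign. *)
exists [set x | forall i, 0 < x 0 i * p 0 i]; split.
- move=> i /=; rewrite -expr2 exprn_even_gt0 //=.
  by have := p0 (enum_val i); rewrite enum_valK.
- rewrite openE => x xp.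
  apply: (@filter_forall _ _
            (fun i => [set y : 'rV[R]_#|root_index D| | 0 < y 0 i * p 0 i])
            (nbhs x) (nbhs_filter x)) => i.
  apply: open_nbhs_nbhs; split; last exact: xp.
  apply: (@open_comp _ _ (fun x : 'rV[R]_#|root_index D| => x 0 i * p 0 i)
            [set t | 0 < t]); last exact: open_gt.
  move=> y _; apply: continuousM; last exact: cst_continuous.
  exact: coord_continuous.
- move=> x xp; apply/V_ringP => I; apply/eqP => xI0.
  by have := xp (enum_rank I); rewrite xI0 mul0r ltxx.
- move=> x xp; split=> [[/W_ofP[x1 xN1] _] i|xpE].
    rewrite inE => iJ; have := xp i.
    have xJ : x 0 i = 1 \/ x 0 i = -1.
      have [iJ2|iJ2] := boolP (enum_val i \in J2).
        by left; have := x1 _ iJ2; rewrite enum_valK.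
      by have := xN1 (enum_val i); rewrite enum_valK inE iJ2; apply.
    have := pJ _ iJ; rewrite enum_valK.
    by case: xJ => ->; case=> -> //; rewrite ?mulr1 ?mul1r ltr0N1.
  have xJ I : I \in J -> x 0 (enum_rank I) = p 0 (enum_rank I).
    by move=> IJ; apply: xpE; rewrite inE enum_rankK.
  split; last first.
    apply/V_ringP => I; apply/eqP => xI0.
    by have := xp (enum_rank I); rewrite xI0 mul0r ltxx.
  apply/W_ofP; split=> I IJ; first by rewrite xJ ?p1 // (fintype.subsetP J2J).
  by rewrite xJ; [exact: pN1|move: IJ; rewrite inE => /andP[]].
Qed.

Variable ord : 'I_#|root_index D| -> root_index D.
Hypothesis ord_bij : bijective ord.
Variables J2 J : {set root_index D}.
Hypothesis J2J : J2 \subset J.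
Hypothesis J2max : maxset (fun S : {set root_index D} =>
  indep_rows (map_mx (intr : int -> 'F_2) (root_matrix ord)) (ord @^-1: S)) J2.
Hypothesis Jmax : maxset (fun S : {set root_index D} =>
  indep_rows (map_mx (intr : int -> R) (root_matrix ord)) (ord @^-1: S)) J.

Lemma morph_weight_mul (F : fieldType) (h : R -> F) (d : 'rV[R]_n) r :
  (forall x y, x != 0 -> y != 0 -> h (x * y) = h x + h y) ->
  (forall i, d 0 i != 0) ->
  h (weight d (val (ord r))) =
  (map_mx intr (root_matrix ord) *m \col_i h (d 0 i)) r 0.
Proof.
move=> hM d0; rewrite root_matrix_mul mxE morph_weight //; congr (_ - _).
by apply: eq_bigr => i _; rewrite mxE.
Qed.

Lemma exists_weight_normalizing c : (forall I, c I != 0) ->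
  exists2 d : 'rV[R]_n, (forall i, d 0 i != 0) &
    W_of R J2 J (lincomb (fun I => weight d (val I) * c I)).
Proof.
move=> c0; have [g _ gK] := ord_bij.
have [indepJ _] := maxsetP Jmax; have [indepJ2 _] := maxsetP J2max.
have [t tJ] := indep_rows_solve (fun r => - log_abs (c (ord r))) indepJ.
have [u uJ2] := indep_rows_solve (fun r => - sign_bit (c (ord r))) indepJ2.
(* Absolute values (from [t]) and signs (from [u]) of the entries can be prescribed
   independently. *)
have [d dE] := choice (fun i => sign_log_surj (t i 0) (u i 0)).
pose d' : 'rV[R]_n := \row_i d i.
have d0 i : d' 0 i != 0 by rewrite mxE; have [] := dE i.
have dt : \col_i log_abs (d' 0 i) = t.
  by apply/colP => i; rewrite !mxE; have [] := dE i.
have du : \col_i sign_bit (d' 0 i) = u.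
  by apply/colP => i; rewrite !mxE; have [] := dE i.
have w0 (I : root_index D) : weight d' (val I) != 0 by apply: weight_neq0.
have wc0 I : weight d' (val I) * c I != 0 by exact: (mulf_neq0 (w0 I) (c0 I)).
have logJ I : I \in J -> log_abs (weight d' (val I) * c I) = log_abs 1.
  move=> IJ; rewrite log_absM ?w0 // -(gK I).
  rewrite (morph_weight_mul _ (@log_absM R)) // dt tJ ?inE ?gK //.
  by rewrite addNr /log_abs normr1 ln1.
have signJ2 : forall I, I \in J2 ->
    sign_bit (weight d' (val I) * c I) = sign_bit (1 : R).
  move=> I IJ; rewrite sign_bitM ?w0 // -(gK I).
  rewrite (morph_weight_mul _ (@sign_bitM R)) // du uJ2 ?inE ?gK //.
  by rewrite addNr /sign_bit ltr10.
exists d' => //; apply/W_ofP; split=> I.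
  move=> IJ2; apply: sign_log_inj; rewrite ?wc0 ?oner_neq0 //.
    by apply: logJ; apply: (fintype.subsetP J2J).
  exact: signJ2.
rewrite inE => /andP[_ /logJ logI].
set x := _ * _ in logI *.
have x0 : x != 0 by exact: wc0.
have : `|x| = 1.
  by apply: (ln_inj _ _ _); rewrite ?posrE ?normr_gt0 // -[1]normr1.
by move/eqP; rewrite eqr_norml ler01 andbT => /orP[] /eqP; [left|right].
Qed.

(** Only the weights are compared: [d] and [d'] may differ by an element acting trivially. *)
Lemma weight_normalizing_unique c (d d' : 'rV[R]_n) :
  (forall I, c I != 0) -> (forall i, d 0 i != 0) -> (forall i, d' 0 i != 0) ->
  W_of R J2 J (lincomb (fun I => weight d (val I) * c I)) ->
  W_of R J2 J (lincomb (fun I => weight d' (val I) * c I)) ->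
  forall I : root_index D, weight d (val I) = weight d' (val I).
Proof.
move=> c0 d0 d'0 /W_ofP[W1 W2] /W_ofP[W1' W2'].
have [g _ gK] := ord_bij.
have wJ I : I \in J -> log_abs (weight d (val I)) = log_abs (weight d' (val I)).
  move=> IJ; apply: (addIr (log_abs (c I))).
  rewrite -!log_absM ?weight_neq0 //.
  have pm1 x : x = 1 \/ x = -1 -> log_abs x = 0 :> R.
    by case=> ->; rewrite /log_abs ?normrN normr1 ln1.
  have [IJ2|IJ2] := boolP (I \in J2); first by rewrite W1 ?W1'.
  by rewrite !pm1 //; [apply: W2'|apply: W2]; rewrite inE IJ2.
have wJ2 I : I \in J2 ->
    sign_bit (weight d (val I)) = sign_bit (weight d' (val I)).
  move=> IJ2; apply: (addIr (sign_bit (c I))).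
  by rewrite -!sign_bitM ?weight_neq0 // W1 ?W1'.
(* Maximality extends agreement from [S] to all indices: the root matrix kills the difference of the
   two [h]-vectors once it does so on the rows in [S]. *)
have spread (F : fieldType) (h : R -> F) S :
    (forall x y, x != 0 -> y != 0 -> h (x * y) = h x + h y) ->
    maxset (fun S : {set root_index D} =>
      indep_rows (map_mx (intr : int -> F) (root_matrix ord)) (ord @^-1: S))
      S ->
    (forall I, I \in S -> h (weight d (val I)) = h (weight d' (val I))) ->
    forall I, h (weight d (val I)) = h (weight d' (val I)).
  move=> hM maxS wS I; rewrite -(gK I) !morph_weight_mul //.
  apply/eqP; rewrite -subr_eq0; apply/eqP.
  set M := map_mx _ _; pose t := \col_i h (d 0 i) - \col_i h (d' 0 i).
  have MtE r : (M *m t) r 0 = (M *m \col_i h (d 0 i)) r 0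
                             - (M *m \col_i h (d' 0 i)) r 0.
    by rewrite mulmxBr !mxE.
  rewrite -MtE (maximal_indep_rows_ker ord_bij maxS) ?mxE // => r rS.
  by rewrite MtE -!morph_weight_mul // wS ?subrr.
move=> I; apply: sign_log_inj; rewrite ?weight_neq0 //.
  exact: spread (@log_absM R) Jmax wJ I.
exact: spread (@sign_bitM R) J2max wJ2 I.
Qed.

End FundamentalDomain.

Theorem proposition2p2 (R : realType) (n : nat) (D : labeled_diagram 'I_n)
    (N1 : cond_N1 D) (N2 : cond_N2 D) (N3 : cond_N3 D)
    (ord : 'I_#|root_index D| -> root_index D) (ord_bij : bijective ord)
    (J2 J : {set root_index D}) (J2J : J2 \subset J)
    (J2max : maxset (fun S : {set root_index D} =>
       indep_rows (map_mx (intr : int -> 'F_2) (root_matrix ord))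
         (ord @^-1: S)) J2)
    (Jmax : maxset (fun S : {set root_index D} =>
       indep_rows (map_mx (intr : int -> R) (root_matrix ord))
         (ord @^-1: S)) J) :
  fundamental_domain D (W_of R J2 J `&` V_ring R D).
Proof.
split; [exact: subIsetr|exact: submanifold_W_ring|].
move=> _ [c c0 <-].
have [d d0 Wd] := exists_weight_normalizing N3 ord_bij J2J J2max Jmax c0.
exists (lincomb (fun I => weight d (val I) * c I)).
apply/seteqP; split; last first.
  move=> w ->; split; first split=> //.
    by apply/(V_ringP N3) => I; rewrite mulf_neq0 ?weight_neq0 //; apply: c0.
  by exists (diag_mx d); [apply/DnP; exists d|apply: gl_act_lincomb].
move=> w [[Ww _] [g /DnP[d' -> d'0] gw]]; move: Ww.
rewrite -gw gl_act_lincomb // => Wd' /=.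
congr lincomb; apply/funext => I; congr (_ * _).
(* Equal weights give equal coefficients, hence the same point of the orbit. *)
exact: (weight_normalizing_unique N3 ord_bij J2max Jmax c0 d'0 d0 Wd' Wd).
Qed.
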